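(* Let $A\in\mathbb{M}_n(\mathbb{C})$ with $\mathrm{rank}(A)=r>0$ and $\mathrm{ind}(A)=k$, and let $$A=U\begin{bmatrix}\Sigma K&\Sigma L\\0&0\end{bmatrix}U^*$$ be a Hartwig-Spindelböck decomposition of $A$. Then the following statements are equivalent: (i) $A$ is CEPD; (ii) $\Sigma K$ is CEPD and $(\Sigma K)^{k-1}\Sigma L=0$; (iii) $A^{\mathrm{cep}}=A^{D,\dagger}$ and $(\Sigma K)^{k-1}\Sigma L=0$.
   Context: $\mathbb{M}_n(\mathbb{C})$ is the algebra of $n\times n$ complex matrices; $^*$ is conjugate transpose; $\mathcal{R}(\cdot)$ is column space; $M^0=I$. The index $\mathrm{ind}(A)$ is the smallest integer $k\ge 0$ with $\mathrm{rank}(A^k)=\mathrm{rank}(A^{k+1})$. $A^\dagger$ is the Moore-Penrose inverse. For a square matrix $A$ with $k=\mathrm{ind}(A)$: the Drazin inverse $A^D$ is the unique $X$ with $AX=XA$, $XAX=X$, $XA^{k+1}=A^k$; the core EP inverse of $A$, denoted here $A^{\mathrm{cep}}$, is the unique $X$ with $XAX=X$ and $\mathcal{R}(X)=\mathcal{R}(A^k)=\mathcal{R}(X^* )$; the DMP inverse is $A^{D,\dagger}=A^DAA^\dagger$ (equivalently, the unique $X$ with $XA=A^DA$, $XAX=X$, $A^kX=A^kA^\dagger$). $A$ is called core EP Drazin (CEPD) if $A^{\mathrm{cep}}A^D=A^DA^{\mathrm{cep}}$. Hartwig-Spindelböck decomposition: $U\in\mathbb{M}_n(\mathbb{C})$ is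 unitary, $\Sigma=\mathrm{diag}(\sigma_1I_{n_1},\dots,\sigma_lI_{n_l})$ where $\sigma_1>\dots>\sigma_l>0$ are the distinct nonzero singular values of $A$, $n_1+\dots+n_l=r$, and $K\in\mathbb{M}_r(\mathbb{C})$, $L\in\mathbb{M}_{r\times(n-r)}(\mathbb{C})$ satisfy $KK^*+LL^*=I_r$. If $k=0$ then $A$ is invertible, $r=n$, $L$ is an empty matrix and the condition $(\Sigma K)^{k-1}\Sigma L=0$ is vacuous. *)

(* Defs.v *)
From mathcomp Require Import all_boot all_order all_algebra.
From mathcomp Require Import complex reals.

Set Implicit Arguments.
Unset Strict Implicit.
Unset Printing Implicit Defensive.

Import Order.TTheory GRing.Theory Num.Theory.
Local Open Scope ring_scope.
Local Open Scope sesquilinear_scope.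

(* Everything is defined over a numClosedFieldType C; the complex numbers are
   C = R[i] with R : realType.  M ^t* is the conjugate transpose, and a complex
   number s satisfies 0 <= s iff it is a nonnegative real. *)

Section GeneralizedInverses.
Variable C : numClosedFieldType.

(* Column spaces are compared as row spaces of the transposes. *)
Definition same_colspace m p q (A : 'M[C]_(m, p)) (B : 'M[C]_(m, q)) : bool :=
  (A^T == B^T)%MS.

Lemma trmxC_mul m n p (A : 'M[C]_(m, n)) (B : 'M[C]_(n, p)) :
  (A *m B)^t* = B^t* *m A^t*.
Proof. by rewrite trmx_mul map_mxM. Qed.

Lemma colspaceP m p q (A : 'M[C]_(m, p)) (B : 'M[C]_(m, q)) :
  reflect ((exists X, A = B *m X) /\ (exists Y, B = A *m Y))
          (same_colspace A B).
Proof.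
apply: (iffP andP) => -[].
  move=> /submxP[X eX] /submxP[Y eY]; split.
    by exists X^T; apply: trmx_inj; rewrite trmx_mul trmxK.
  by exists Y^T; apply: trmx_inj; rewrite trmx_mul trmxK.
by move=> [X eX] [Y eY]; split; apply/submxP;
  [exists X^T; rewrite {1}eX trmx_mul | exists Y^T; rewrite {1}eY trmx_mul].
Qed.

Lemma rank_exprS n (A : 'M[C]_n) k : (\rank (A ^+ k.+1) <= \rank (A ^+ k))%N.
Proof. by rewrite exprS; apply: mxrankM_maxr. Qed.

Lemma ind_exists n (A : 'M[C]_n) :
  exists k, \rank (A ^+ k) == \rank (A ^+ k.+1).
Proof.
suff H k : (exists2 j, (j < k)%N & \rank (A ^+ j) == \rank (A ^+ j.+1)) \/
           (\rank (A ^+ k) + k <= n)%N.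
  case: (H n.+1) => [[j _ jP]|]; first by exists j.
  by move/(leq_trans (leq_addl _ _)); rewrite ltnn.
elim: k => [|k [[j jk jP]|IH]].
- by right; rewrite addn0 rank_leq_row.
- by left; exists j => //; apply: ltnW.
have [e|ne] := eqVneq (\rank (A ^+ k)) (\rank (A ^+ k.+1)).
  by left; exists k; rewrite // e.
right; apply: leq_trans IH; rewrite addnS -addSn leq_add2r.
by rewrite ltn_neqAle eq_sym ne rank_exprS.
Qed.

Definition ind n (A : 'M[C]_n) : nat := ex_minn (ind_exists A).

Lemma rank_expr_ind n (A : 'M[C]_n) j :
  \rank (A ^+ (ind A + j)) = \rank (A ^+ ind A).
Proof.
rewrite /ind; case: ex_minnP => k /eqP ek _.
have sub : (A ^+ k <= A ^+ k.+1)%MS.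
  by rewrite -(geq_leqif (mxrank_leqif_sup _)) ?ek // exprS submxMl.
suff sub' : (A ^+ k <= A ^+ (k + j))%MS.
  apply/eqP; rewrite eqn_leq (mxrankS sub') andbT addnC exprD.
  exact: mxrankM_maxr.
elim: j => [|j IH]; first by rewrite addn0.
by rewrite addnS exprSr (submx_trans sub) // exprSr; apply: submxMr.
Qed.

Lemma expr_indE n (A : 'M[C]_n) j :
  (exists X, A ^+ ind A = X *m A ^+ (ind A + j)) /\
  (exists Y, A ^+ ind A = A ^+ (ind A + j) *m Y).
Proof.
have rk := rank_expr_ind A j; split.
  have : (A ^+ ind A <= A ^+ (ind A + j))%MS.
    by rewrite -(geq_leqif (mxrank_leqif_sup _)) ?rk // addnC exprD submxMl.
  by case/submxP => X ->; exists X.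
have : ((A ^+ ind A)^T <= (A ^+ (ind A + j))^T)%MS.
  rewrite -(geq_leqif (mxrank_leqif_sup _)) ?mxrank_tr ?rk //.
  by rewrite exprD -mulmxE trmx_mul submxMl.
by case/submxP => X e; exists X^T; apply: trmx_inj; rewrite trmx_mul trmxK.
Qed.

Definition is_moore_penrose m n (A : 'M[C]_(m, n)) (X : 'M[C]_(n, m)) : bool :=
  [&& A *m X *m A == A, X *m A *m X == X,
      (A *m X)^t* == A *m X & (X *m A)^t* == X *m A].

Lemma gram_unit m n (B : 'M[C]_(m, n)) : row_free B -> B *m B^t* \in unitmx.
Proof.
move=> freeB; rewrite -row_free_unit; apply: inj_row_free => v v0.
have : (v *m B) *m (v *m B)^t* = 0.
  by rewrite trmxC_mul mulmxA -(mulmxA v) v0 mul0mx.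
move/(congr1 (fun M : 'M_1 => M 0 0)); rewrite mxE [RHS]mxE => /eqP.
rewrite psumr_eq0 => [/allP s0|i _]; last by rewrite !mxE mul_conjC_ge0.
have : v *m B = 0.
  apply/rowP=> i; have := s0 i (mem_index_enum i).
  by rewrite !mxE mul_conjC_eq0 => /eqP.
by move/eqP; rewrite mulmx_free_eq0 // => /eqP.
Qed.

Lemma moore_penrose_factor m n r (F : 'M[C]_(m, r)) (G : 'M[C]_(r, n)) :
    F^t* *m F \in unitmx -> G *m G^t* \in unitmx ->
  is_moore_penrose (F *m G)
    (G^t* *m invmx (G *m G^t*) *m invmx (F^t* *m F) *m F^t*).
Proof.
move=> uF uG; set iG := invmx (G *m G^t*); set iF := invmx (F^t* *m F).
have hG : iG^t* = iG.
  by rewrite /iG trmx_inv map_invmx trmxC_mul trmxCK.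
have hF : iF^t* = iF.
  by rewrite /iF trmx_inv map_invmx trmxC_mul trmxCK.
set X := _ *m F^t*.
have eAX : F *m G *m X = F *m iF *m F^t*.
  by rewrite /X !mulmxA -(mulmxA F G) -(mulmxA F _ iG) mulmxV // mulmx1.
have eXA : X *m (F *m G) = G^t* *m iG *m G.
  by rewrite /X !mulmxA -(mulmxA _ _ F) -(mulmxA _ iF) mulVmx // mulmx1.
apply/and4P; split; apply/eqP.
- by rewrite eAX !mulmxA -(mulmxA _ _ F) -(mulmxA F iF) mulVmx // mulmx1.
- rewrite eXA /X !mulmxA -(mulmxA _ G) -(mulmxA _ (G *m _)) mulmxV //.
  by rewrite mulmx1.
- by rewrite eAX !trmxC_mul trmxCK hF mulmxA.
- by rewrite eXA !trmxC_mul trmxCK hG mulmxA.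
Qed.

Lemma moore_penrose_exists m n (A : 'M[C]_(m, n)) :
  exists X, is_moore_penrose A X.
Proof.
have uG : row_base A *m (row_base A)^t* \in unitmx.
  by rewrite gram_unit ?row_base_free.
have uF : (col_base A)^t* *m col_base A \in unitmx.
  rewrite -{2}(trmxCK (col_base A)) gram_unit // -row_leq_rank.
  rewrite mxrank_map mxrank_tr.
  by have := col_base_full A; rewrite /row_full => /eqP ->.
have := moore_penrose_factor uF uG; rewrite mulmx_base.
by move=> AX; eexists; exact: AX.
Qed.

Definition moore_penrose m n (A : 'M[C]_(m, n)) : 'M[C]_(n, m) :=
  xchoose (moore_penrose_exists A).

Lemma moore_penroseP m n (A : 'M[C]_(m, n)) :
  is_moore_penrose A (moore_penrose A).
Proof. exact: xchooseP. Qed.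

Lemma moore_penrose_uniq m n (A : 'M[C]_(m, n)) X :
  is_moore_penrose A X -> X = moore_penrose A.
Proof.
have := moore_penroseP A; move: (moore_penrose A) => Y.
case/and4P => /eqP y1 /eqP y2 /eqP y3 /eqP y4.
case/and4P => /eqP x1 /eqP x2 /eqP x3 /eqP x4.
have eAX : A *m X = A *m Y.
  rewrite -x3 -{1}y1 -(mulmxA _ A X) trmxC_mul x3 y3.
  by rewrite mulmxA x1.
have eXA : X *m A = Y *m A.
  rewrite -x4 -{1}y1 -!mulmxA mulmxA trmxC_mul x4 y4.
  by rewrite -mulmxA (mulmxA A) x1.
by rewrite -x2 -mulmxA eAX mulmxA eXA y2.
Qed.

Definition is_drazin n (A X : 'M[C]_n) : bool :=
  [&& A *m X == X *m A, X *m A *m X == X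
    & X *m A ^+ (ind A).+1 == A ^+ ind A].

Lemma drazin_exists n (A : 'M[C]_n) : exists X, is_drazin A X.
Proof.
have [[Y eY] [Z eZ]] := expr_indE A (ind A).+1; set k := ind A in eY eZ *.
have expA i j : A ^+ i *m A ^+ j = A ^+ (i + j) by rewrite mulmxE exprD.
have cA i : A *m A ^+ i = A ^+ i *m A by rewrite !mulmxE -exprS exprSr.
have AB : A *m A ^+ (k + k.+1) = A ^+ (k + k.+1) *m A by exact: cA.
have eW : Y *m A ^+ k = A ^+ k *m Z by rewrite {2}eY {1}eZ mulmxA.
have eW1 : Y *m A ^+ k *m A = A *m (A ^+ k *m Z).
  by rewrite -mulmxA -cA {1}eZ !mulmxA -(mulmxA Y) AB mulmxA -eY cA.
exists (Y *m A ^+ k); apply/and3P; split; apply/eqP.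
- by rewrite eW1 eW.
- rewrite {2}eW -!mulmxA (mulmxA A) (mulmxA (A ^+ k)) mulmxE -exprS -mulmxE.
  by rewrite expA -eZ.
- by rewrite -mulmxA expA -eY.
Qed.

Definition drazin n (A : 'M[C]_n) : 'M[C]_n := xchoose (drazin_exists A).

Lemma drazinP n (A : 'M[C]_n) : is_drazin A (drazin A).
Proof. exact: xchooseP. Qed.

Lemma drazin_expr n (A X : 'M[C]_n) j : is_drazin A X ->
  A *m X = A ^+ j.+1 *m X ^+ j.+1 /\ A *m X = X ^+ j.+1 *m A ^+ j.+1.
Proof.
case/and3P => /eqP cAX /eqP XAX _; have cX : GRing.comm A X by exact: cAX.
have cX' : GRing.comm X A by exact: commr_sym.
have idAX : (A *m X) ^+ j.+1 = A *m X.
  by elim: j => // j IH; rewrite exprS IH -mulmxE mulmxA -(mulmxA A) -mulmxA XAX.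
split; rewrite -{1}idAX; first by rewrite mulmxE exprMn_comm.
by rewrite cAX mulmxE exprMn_comm.
Qed.

Lemma drazin_proj n (A X Y : 'M[C]_n) : is_drazin A X -> is_drazin A Y ->
  A *m X *m (A *m Y) = A *m X /\ A *m Y *m (A *m X) = A *m X.
Proof.
move=> dX /and3P[/eqP cY _ /eqP Yk].
have [x1 x2] := drazin_expr (ind A) dX.
have cYk : A ^+ (ind A).+1 *m Y = Y *m A ^+ (ind A).+1.
  by apply: commr_sym; apply: commrX; rewrite /GRing.comm -!mulmxE cY.
split; last by rewrite {1}x1 mulmxA -(mulmxA A Y) Yk mulmxE -exprS -mulmxE -x1.
by rewrite {1}x2 cY -mulmxA (mulmxA _ Y) cYk Yk mulmxE -exprSr -mulmxE -x2.
Qed.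

Lemma drazin_uniq n (A X : 'M[C]_n) : is_drazin A X -> X = drazin A.
Proof.
have := drazinP A; move: (drazin A) => Y dY dX.
have eXY : A *m X = A *m Y.
  by rewrite -(proj2 (drazin_proj dX dY)) (proj1 (drazin_proj dY dX)).
case/and3P: dX => /eqP cX /eqP XAX _; case/and3P: dY => /eqP cY /eqP YAY _.
by rewrite -XAX -mulmxA eXY mulmxA -cX eXY cY YAY.
Qed.

Definition is_core_EP n (A X : 'M[C]_n) : bool :=
  [&& X *m A *m X == X, same_colspace X (A ^+ ind A)
    & same_colspace (A ^+ ind A) (X^t*)].

Lemma core_EP_exists n (A : 'M[C]_n) : exists X, is_core_EP A X.
Proof.
set k := ind A; set D := drazin A.
have /and3P[/eqP cD /eqP DAD /eqP Dk] := drazinP A.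
have /and4P[/eqP p1 _ /eqP p3 _] := moore_penroseP (A ^+ k).
set P := A ^+ k *m moore_penrose (A ^+ k) in p1 p3.
have eP : P = A ^+ k *m moore_penrose (A ^+ k) by [].
clearbody P.
have cDk : A ^+ k *m D = D *m A ^+ k.
  by apply: commr_sym; apply: commrX; rewrite /GRing.comm -!mulmxE cD.
have ADk : A *m D *m A ^+ k = A ^+ k.
  by rewrite cD -mulmxA mulmxE -exprS -mulmxE Dk.
have ADP : A *m D *m P = P by rewrite eP mulmxA ADk.
have PP : P *m P = P by rewrite {2}eP mulmxA p1.
exists (D *m P); apply/and3P; split.
- by rewrite -!mulmxA (mulmxA A D) ADP PP.
- apply/colspaceP; split.
    by exists (D *m moore_penrose (A ^+ k)); rewrite eP !mulmxA cDk.
  by exists (A ^+ k.+1); rewrite exprSr -mulmxE !mulmxA -(mulmxA D) p1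
     -mulmxA mulmxE -exprSr -mulmxE Dk.
apply/colspaceP; split.
  exists (A^t* *m A ^+ k); rewrite mulmxA -trmxC_mul mulmxA ADP p3.
  by rewrite p1.
exists (moore_penrose (A ^+ k) *m D^t*).
by rewrite trmxC_mul p3 mulmxA -eP.
Qed.

Definition core_EP n (A : 'M[C]_n) : 'M[C]_n := xchoose (core_EP_exists A).

Lemma core_EPP n (A : 'M[C]_n) : is_core_EP A (core_EP A).
Proof. exact: xchooseP. Qed.

Lemma core_EP_uniq n (A X : 'M[C]_n) : is_core_EP A X -> X = core_EP A.
Proof.
have := core_EPP A; move: (core_EP A) => Y.
case/and3P => /eqP YAY /colspaceP[[U eU] _] /colspaceP[[S eS] _].
case/and3P => /eqP XAX /colspaceP[_ [V eV]] /colspaceP[_ [T eT]].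
have XAY : X *m A *m Y = Y by rewrite eU eV !mulmxA XAX.
have eX : X = (S *m T)^t* *m Y.
  by rewrite -(trmxCK Y) -trmxC_mul mulmxA -eS -eT trmxCK.
by rewrite -XAY {2}eX -!mulmxA (mulmxA Y) YAY -eX.
Qed.

Definition DMP n (A : 'M[C]_n) : 'M[C]_n := drazin A *m A *m moore_penrose A.

Definition CEPD n (A : 'M[C]_n) : Prop :=
  core_EP A *m drazin A = drazin A *m core_EP A.

Definition singular_value n (A : 'M[C]_n) (s : C) : Prop :=
  0 <= s /\ eigenvalue (A^t* *m A) (s ^+ 2).

(* Sigma = diag(sigma_1 I_(n_1), ..., sigma_l I_(n_l)), the cast identifying
   n_1 + ... + n_l with r. *)
Definition singular_diag n (A : 'M[C]_n) r (Sigma : 'M[C]_r) : Prop :=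
  exists (l : nat) (n_ : 'I_l -> nat) (sigma : 'I_l -> C)
         (e : (\sum_(i < l) n_ i)%N = r),
    [/\ Sigma = castmx (e, e) (\mxdiag_(i < l) ((sigma i)%:M : 'M_(n_ i))),
        forall i, (0 < n_ i)%N,
        forall i j : 'I_l, (i < j)%N -> sigma j < sigma i
      & forall s, (exists i, s = sigma i) <-> (singular_value A s /\ s != 0)].

(* The order is n = r + m, i.e. m stands for n - r. *)
Definition hartwig_spindelboeck r m (A U : 'M[C]_(r + m))
    (Sigma K : 'M[C]_r) (L : 'M[C]_(r, m)) : Prop :=
  [/\ U \is unitarymx,
      singular_diag A Sigma,
      K *m K^t* + L *m L^t* = 1%:M
    & A = U *m block_mx (Sigma *m K) (Sigma *m L) 0 0 *m U^t*].

End GeneralizedInverses.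

(* Main.v *)
(* The matrix A is CEPD iff the idempotent A A^D is Hermitian, iff its core EP
   and Drazin inverses coincide.  With U = [V W], put G = [Sigma K, Sigma L] U^*;
   then A = V G while Sigma K = G V and Sigma L = G W, so Cline's formula
   transports the Drazin inverse between A and Sigma K, and
   (Sigma K)^(k-1) Sigma L = 0 says exactly that A^k = A^k V V^*, where
   V V^* = A A^+ because rank A = r. *)
Require Import Defs.
From mathcomp Require Import all_boot all_order all_algebra.
From mathcomp Require Import complex reals.

Set Implicit Arguments.
Unset Strict Implicit.
Unset Printing Implicit Defensive.

Import Order.TTheory GRing.Theory Num.Theory.
Local Open Scope ring_scope.

Section CoreEPDrazin.
Local Open Scope sesquilinear_scope.
Variable C : numClosedFieldType.

(** * Identities for the Drazin inverse, up to Cline's formula *)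

Lemma drazin_comm n (A : 'M[C]_n) : A *m drazin A = drazin A *m A.
Proof. by have /and3P[/eqP] := drazinP A. Qed.

Lemma drazin_expr_comm n (A : 'M[C]_n) i j :
  A ^+ i *m drazin A ^+ j = drazin A ^+ j *m A ^+ i.
Proof. by apply/commrX/commr_sym/commrX/commr_sym/drazin_comm. Qed.

Lemma drazin_outer n (A : 'M[C]_n) : drazin A *m A *m drazin A = drazin A.
Proof. by have /and3P[_ /eqP] := drazinP A. Qed.

Lemma drazin_mul_expr n (A : 'M[C]_n) :
  A *m drazin A *m A ^+ ind A = A ^+ ind A.
Proof.
have /and3P[_ _ /eqP Dk] := drazinP A.
by rewrite drazin_comm -mulmxA mulmxE -exprS -mulmxE Dk.
Qed.

Lemma expr_mul_drazin n (A : 'M[C]_n) :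
  A ^+ ind A *m (A *m drazin A) = A ^+ ind A.
Proof.
rewrite -{2}(drazin_mul_expr A); apply/commr_sym/commrX/commr_sym/commrM => //.
exact: drazin_comm.
Qed.

Lemma drazin_exprl n (A : 'M[C]_n) j :
  drazin A = drazin A ^+ j.+1 *m A ^+ j.
Proof.
elim: j => [|j IH]; first by rewrite expr1 expr0 mulmx1.
rewrite exprS (exprSr A) -!mulmxE mulmxA -(mulmxA (drazin A)) -IH -mulmxA.
by rewrite -drazin_comm mulmxA drazin_outer.
Qed.

(** The exponent [j] is free: since [A ^+ ind A] factors through [A ^+ (ind A + j)], the power
    identity at any exponent passes to the index. *)
Lemma is_drazin_expr n (A X : 'M[C]_n) j :
    A *m X = X *m A -> X *m A *m X = X -> X *m A ^+ j.+1 = A ^+ j ->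
  is_drazin A X.
Proof.
move=> cAX XAX Xj; apply/and3P; split; apply/eqP => //.
have [_ [Y eY]] := expr_indE A j.
have Xij : X *m A ^+ (ind A + j).+1 = A ^+ (ind A + j).
  by rewrite addnC -addSn !exprD -!mulmxE mulmxA Xj.
by rewrite exprS {1}eY -mulmxE !mulmxA -(mulmxA X) mulmxE -exprS -mulmxE Xij -eY.
Qed.

Lemma exprM_swap p q (V : 'M[C]_(p, q)) (G : 'M[C]_(q, p)) j :
  (V *m G) ^+ j.+1 = V *m (G *m V) ^+ j *m G.
Proof.
elim: j => [|j IH]; first by rewrite expr1 expr0 mulmx1.
by rewrite exprSr IH exprSr -!mulmxE !mulmxA.
Qed.

(** Cline's formula. The candidate is checked at exponent [(ind B).+1], where [B] is [G *m V], so
    the index of [V *m G] need not be computed. *)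
Lemma drazin_swap p q (V : 'M[C]_(p, q)) (G : 'M[C]_(q, p)) :
  drazin (V *m G) = V *m drazin (G *m V) *m drazin (G *m V) *m G.
Proof.
have [B eB] : exists B, G *m V = B by exists (G *m V).
rewrite eB; set X := drazin B.
have cX : B *m X = X *m B := drazin_comm B.
have XBX : X *m B *m X = X := drazin_outer B.
have eAX : V *m G *m (V *m X *m X *m G) = V *m X *m G.
  by rewrite !mulmxA -(mulmxA V G V) eB -(mulmxA V B) cX -(mulmxA V _ X) XBX.
have eXA : V *m X *m X *m G *m (V *m G) = V *m X *m G.
  rewrite !mulmxA -(mulmxA _ G V) eB -(mulmxA _ X B) -cX !mulmxA.
  by rewrite -(mulmxA V X B) -(mulmxA V _ X) XBX.
apply/esym/drazin_uniq/(@is_drazin_expr _ _ _ (ind B).+1); first by rewrite eAX.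
  rewrite eXA !mulmxA -(mulmxA _ G V) eB.
  by rewrite -(mulmxA V X B) -(mulmxA V _ X) XBX.
rewrite (exprS _ (ind B).+1) -mulmxE mulmxA eXA exprM_swap eB !mulmxA.
rewrite -(mulmxA _ G V) eB -(mulmxA V) -cX -(mulmxA V).
by rewrite drazin_mul_expr.
Qed.

(** * Characterizations of CEPD matrices *)

(** The columns of the core EP inverse [X] and of the Drazin inverse lie in the range of
    [A ^+ ind A], on which both [X *m A] and [A *m drazin A] act as the identity. *)
Lemma core_EP_drazin_mul n (A : 'M[C]_n) :
  core_EP A *m A *m drazin A = drazin A /\
  A *m drazin A *m core_EP A = core_EP A.
Proof.
have /and3P[/eqP XAX /colspaceP[[S eS] [T eT]] _] := core_EPP A.
set X := core_EP A in XAX eS eT *; split; last first.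
  by rewrite eS mulmxA drazin_mul_expr.
have XAk : X *m A *m A ^+ ind A = A ^+ ind A by rewrite eT mulmxA XAX.
have -> : drazin A = A ^+ ind A *m drazin A ^+ (ind A).+1.
  by rewrite {1}(drazin_exprl A (ind A)) drazin_expr_comm.
by rewrite mulmxA XAk.
Qed.

(** The product [E = A X] fixes the range of [A ^+ ind A], which contains that of [X^*]. So
    [E X^* = X^*], whence [X E^* = X] and [E E^* = E]. *)
Lemma mul_core_EP_herm n (A : 'M[C]_n) :
  (A *m core_EP A)^t* = A *m core_EP A.
Proof.
have [XAD _] := core_EP_drazin_mul A.
have /and3P[_ _ /colspaceP[_ [S eS]]] := core_EPP A.
set X := core_EP A in XAD eS *.
have AXk : A *m X *m A ^+ ind A = A ^+ ind A.
  rewrite -{1}(drazin_mul_expr A) !mulmxA -(mulmxA A X A).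
  by rewrite -(mulmxA A _ (drazin A)) XAD drazin_mul_expr.
have EE : A *m X *m (A *m X)^t* = A *m X.
  have XE : A *m X *m X^t* = X^t* by rewrite eS mulmxA AXk.
  have XE' : X *m (A *m X)^t* = X.
    by rewrite -{1}(trmxCK X) -trmxC_mul XE trmxCK.
  by rewrite -mulmxA XE'.
by rewrite -{1}EE trmxC_mul trmxCK EE.
Qed.

Lemma CEPD_tfae n (A : 'M[C]_n) :
  [<-> CEPD A;
       (A *m drazin A)^t* = A *m drazin A;
       core_EP A = drazin A].
Proof.
set D := drazin A.
have DAD : D *m A *m D = D := drazin_outer A.
have cD : A *m D = D *m A := drazin_comm A.
tfae.
- have [XAD ADX] := core_EP_drazin_mul A.
  rewrite /CEPD -/D => XD.
  suff -> : A *m D = A *m core_EP A by apply: mul_core_EP_herm.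
  (* Commutation gives [D X = X D = X A D D = D D], and then [X = A D X = A D D = D]. *)
  have DX : D *m core_EP A = D *m D.
    by rewrite -XD -{1}DAD -cD !mulmxA XAD.
  by rewrite -ADX -(mulmxA A D) DX (mulmxA A D) cD DAD cD.
- move=> hZ; apply/esym/core_EP_uniq/and3P; split.
  + by rewrite DAD.
  + apply/colspaceP; split.
      exists (D ^+ (ind A).+1).
      by rewrite {1}/D {1}(drazin_exprl A (ind A)) drazin_expr_comm.
    by exists (A *m A ^+ ind A); rewrite mulmxA -cD drazin_mul_expr.
  (* With [Z = A D] Hermitian and [k] the index, [A^k = Z A^k = D^* A^* A^k]; conversely
     [D^* = Z D^*], where [Z = A^(k+1) D^(k+1)]. *)
  apply/colspaceP; split.
    by exists (A^t* *m A ^+ ind A); rewrite mulmxA -trmxC_mul hZ drazin_mul_expr.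
  exists (A *m D ^+ (ind A).+1 *m D^t*).
  have [eAD _] := drazin_expr (ind A) (drazinP A).
  rewrite (exprSr A) -!mulmxE -/D in eAD.
  by rewrite !mulmxA -eAD -hZ -trmxC_mul mulmxA DAD.
- by rewrite /CEPD => ->.
Qed.

Lemma CEPD_herm n (A : 'M[C]_n) :
  CEPD A <-> (A *m drazin A)^t* = A *m drazin A.
Proof. exact: (CEPD_tfae A 0 1). Qed.

Lemma CEPD_core_EP n (A : 'M[C]_n) : CEPD A <-> core_EP A = drazin A.
Proof. exact: (CEPD_tfae A 0 2). Qed.

Lemma CEPD_DMP n (A : 'M[C]_n) : CEPD A -> core_EP A = DMP A.
Proof.
move=> cA; have /CEPD_core_EP -> := cA; have /CEPD_herm hZ := cA.
have /and4P[/eqP p1 _ /eqP p3 _] := moore_penroseP A.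
(* The orthogonal projector [A A^+] fixes [A A^D] from the left; taking adjoints, the Hermitian
   [A A^D] absorbs it on the right. *)
have ADP : A *m drazin A *m (A *m moore_penrose A) = A *m drazin A.
  by rewrite -[LHS]trmxCK trmxC_mul hZ p3 mulmxA p1 hZ.
rewrite /DMP -{2}(drazin_outer A) -(mulmxA _ A (drazin A)).
by rewrite -!(mulmxA (drazin A)) -(mulmxA _ A) ADP mulmxA drazin_outer.
Qed.

Lemma ind0_CEPD n (A : 'M[C]_n) : ind A = 0%N -> CEPD A.
Proof.
move=> iA; apply/CEPD_herm; have /and3P[_ _] := drazinP A.
rewrite iA expr1 expr0 -drazin_comm => /eqP ->.
by rewrite trmx1 map_mx1.
Qed.

Lemma unitary_row_mx r m
    (V : 'M[C]_(r + m, r)) (W : 'M[C]_(r + m, m)) :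
    row_mx V W \is unitarymx ->
  [/\ V^t* *m V = 1%:M, V^t* *m W = 0, W^t* *m V = 0, W^t* *m W = 1%:M
    & V *m V^t* + W *m W^t* = 1%:M].
Proof.
move=> uU; have /unitarymxP := uU; have := uU.
rewrite -trmxC_unitary => /unitarymxP; rewrite trmxCK.
rewrite tr_row_mx map_col_mx mul_row_col mul_col_row scalar_mx_block.
by case/eq_block_mx.
Qed.

End CoreEPDrazin.

(** * Transfer of the CEPD property between [V *m G] and [G *m V] for an isometry [V] *)

Section IsometricFactor.
Local Open Scope sesquilinear_scope.
Variables (C : numClosedFieldType) (n r m : nat).
Variables (V : 'M[C]_(n, r)) (W : 'M[C]_(n, m)) (G : 'M[C]_(r, n)).
Hypothesis VV : V^t* *m V = 1%:M.
Hypothesis VW : V^t* *m W = 0.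
Hypothesis VVWW : V *m V^t* + W *m W^t* = 1%:M.

Variables (A : 'M[C]_n) (B : 'M[C]_r).
Hypothesis AE : V *m G = A.
Hypothesis BE : G *m V = B.

Let GE : G = B *m V^t* + G *m W *m W^t*.
Proof. by rewrite -BE -!mulmxA -mulmxDr VVWW mulmx1. Qed.

(** Cline's formula makes [B B^D] the compression of [A A^D] by the isometry [V], and compressions
    of Hermitian matrices are Hermitian. *)
Lemma CEPD_isometric_factor : CEPD A -> CEPD B.
Proof.
move/CEPD_herm => hZ; apply/CEPD_herm.
suff -> : B *m drazin B = V^t* *m (A *m drazin A) *m V.
  by rewrite (trmxC_mul _ V) (trmxC_mul (V^t*)) trmxCK hZ mulmxA.
rewrite -BE drazin_swap AE !mulmxA -AE !mulmxA VV mul1mx -(mulmxA G V G) AE.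
by rewrite -(mulmxA G A) drazin_comm -(mulmxA G _ (drazin A)) drazin_outer.
Qed.

(** The Hermitian [A A^D] has range inside that of [V], so it absorbs [V V^*] on the right, and
    hence so does [A^(j+1) = V B^j G]. Multiplying by [V^*] on the left and [W] on the right leaves
    [B^j G W = 0]. *)
Lemma CEPD_isometric_vanish j :
  ind A = j.+1 -> CEPD A -> B ^+ j *m (G *m W) = 0.
Proof.
move=> iA /CEPD_herm hZ.
have ZQ : A *m drazin A *m (V *m V^t*) = A *m drazin A.
  have hQ : (V *m V^t*)^t* = V *m V^t* by rewrite trmxC_mul trmxCK.
  have QA : V *m V^t* *m A = A.
    by rewrite -AE !mulmxA -(mulmxA V (V^t*)) VV mulmx1.
  by rewrite -[LHS]trmxCK trmxC_mul hQ hZ mulmxA QA hZ.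
have := expr_mul_drazin A; rewrite -ZQ iA mulmxA -iA expr_mul_drazin iA.
rewrite -AE exprM_swap BE => /(congr1 (fun M => V^t* *m M *m W)).
by rewrite -!mulmxA VW !mulmx0 !mulmxA VV mul1mx => ->.
Qed.

(** As [B^D] has [B^j] as a right factor, it annihilates [G W], so [B^D G = B B^D V^*]; Cline's
    formula then gives [A A^D = V B B^D V^*]. *)
Lemma CEPD_of_isometric_factor j :
  B ^+ j *m (G *m W) = 0 -> CEPD B -> CEPD A.
Proof.
move=> BW /CEPD_herm hB; apply/CEPD_herm.
have XGW : drazin B *m G *m W = 0.
  by rewrite (drazin_exprl B j) -!mulmxA BW mulmx0.
have XG : drazin B *m G = B *m drazin B *m V^t*.
  by rewrite {1}GE mulmxDr (mulmxA _ (G *m W)) (mulmxA _ G) XGW mul0mx addr0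
             mulmxA drazin_comm.
suff -> : A *m drazin A = V *m (B *m drazin B) *m V^t*.
  by rewrite (trmxC_mul _ (V^t*)) (trmxC_mul V) trmxCK hB mulmxA.
rewrite -AE drazin_swap BE -!mulmxA (mulmxA B) -XG (mulmxA G) BE.
by rewrite (mulmxA B) drazin_comm (mulmxA _ _ G) drazin_outer.
Qed.

(** The range of [A] lies in that of [V], and rank [r] forces equality; both sides are the
    orthogonal projector onto it. *)
Lemma mul_moore_penrose_isometric :
  \rank A = r -> A *m moore_penrose A = V *m V^t*.
Proof.
move=> rA; have /and4P[/eqP p1 _ /eqP p3 _] := moore_penroseP A.
have : (V^T <= A^T)%MS.
  rewrite -(geq_leqif (mxrank_leqif_sup _)).
    by rewrite mxrank_tr mxrank_tr rA rank_leq_col.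
  by rewrite -AE trmx_mul submxMl.
case/submxP => Z /(congr1 trmx); rewrite trmxK trmx_mul trmxK => eV.
have PV : A *m moore_penrose A *m V = V by rewrite eV mulmxA p1.
have VP : V^t* *m (A *m moore_penrose A) = V^t*.
  by rewrite -[LHS]trmxCK trmxC_mul p3 trmxCK PV.
by rewrite -VP -AE !mulmxA -(mulmxA V (V^t*)) VV mulmx1.
Qed.

(** The vanishing condition gives [A^(j+1) V V^* = A^(j+1)], and [A^D] has [A^(j+1)] as a right
    factor, so the DMP inverse reduces to [A^D]. *)
Lemma CEPD_of_core_EP_DMP j : \rank A = r ->
  B ^+ j *m (G *m W) = 0 -> core_EP A = DMP A -> CEPD A.
Proof.
move=> rA BW XA; apply/CEPD_core_EP; rewrite XA /DMP -mulmxA.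
rewrite mul_moore_penrose_isometric //.
rewrite {1}(drazin_exprl A j.+1) -mulmxA.
suff -> : A ^+ j.+1 *m (V *m V^t*) = A ^+ j.+1 by rewrite -drazin_exprl.
rewrite -AE exprM_swap BE -!mulmxA; congr (V *m _).
by rewrite (mulmxA G) BE [in RHS]GE mulmxDr (mulmxA _ (G *m W)) BW mul0mx addr0.
Qed.

End IsometricFactor.

Theorem theorem3p3 (R : realType) (r m k : nat) (A U : 'M[R[i]]_(r + m))
    (Sigma K : 'M[R[i]]_r) (L : 'M[R[i]]_(r, m))
    (r_gt0 : (0 < r)%N) (rankA : \rank A = r) (indA : ind A = k)
    (HS : hartwig_spindelboeck A U Sigma K L) :
  [<-> CEPD A;
       CEPD (Sigma *m K) /\
         ((0 < k)%N -> (Sigma *m K) ^+ k.-1 *m Sigma *m L = 0);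
       core_EP A = DMP A /\
         ((0 < k)%N -> (Sigma *m K) ^+ k.-1 *m Sigma *m L = 0)].
Proof.
case: HS => uU _ _.
rewrite -(hsubmxK U); move: (lsubmx U) (rsubmx U) (hsubmxK U) => V W eU.
rewrite -eU in uU; have [VV VW WV WW VVWW] := unitary_row_mx uU.
set G := (Sigma *m K *m V^t* + Sigma *m L *m W^t*)%sesqui.
rewrite tr_row_mx map_col_mx mul_row_block !mulmx0 !addr0 mul_row_col.
rewrite -!(mulmxA V) -mulmxDr -/G => eA.
have GV : G *m V = Sigma *m K.
  by rewrite mulmxDl -mulmxA VV -(mulmxA _ _ V) WV mulmx0 addr0 mulmx1.
have GW : G *m W = Sigma *m L.
  by rewrite mulmxDl -mulmxA VW -(mulmxA _ _ W) WW mulmx0 add0r mulmx1.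
(* In index zero the guard [0 < k] is false and [A] is CEPD outright; otherwise [k] is [j.+1], so
   that [k.-1] is [j]. *)
rewrite -mulmxA -GW; case: k indA => [|j] iA.
  tfae.
  - by move=> cA; split=> //; apply: (CEPD_isometric_factor VV (esym eA) GV).
  - by move=> _; split=> //; apply/CEPD_DMP/ind0_CEPD.
  - by move=> _; apply: ind0_CEPD.
tfae.
- move=> cA; split=> [|_].
    exact: (CEPD_isometric_factor VV (esym eA) GV).
  exact: (CEPD_isometric_vanish VV VW (esym eA) GV iA).
- case=> cB /(_ isT) BW; split=> //; apply: CEPD_DMP.
  exact: (CEPD_of_isometric_factor VVWW (esym eA) GV BW).
- case=> XA /(_ isT) BW.
  exact: (CEPD_of_core_EP_DMP VV VVWW (esym eA) GV rankA BW).
Qed.
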